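(* For all sufficiently large $n$, we have $$9^n<R_n<12.75^n.$$
   Context: For an integer $n\ge 0$, let $\mathcal{Q}(n)=\{(x,y)\in\mathbb{Z}^2: 0\le x,\ 0\le y,\ x+y\le n\}$. Let $\mathcal{R}(n)$ be the set of all subsets $Y\subseteq\mathcal{Q}(n)$ such that: for any $(a,b),(c,d)\in Y$ with $\max(a,c)+\max(b,d)\le n+1$, we have $(\min(a,c),\min(b,d))\in Y$ and, additionally, $(\max(a,c),\max(b,d))\in Y$ as soon as $(\max(a,c),\max(b,d))\in\mathcal{Q}(n)$. Put $R_n=|\mathcal{R}(n)|$. *)

(* Defs.v *)
From mathcomp Require Import all_boot all_order all_algebra.

Set Implicit Arguments.
Unset Strict Implicit.
Unset Printing Implicit Defensive.

(* All lattice points of Q(n) have both coordinates in {0, ..., n}, so they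
   are taken in the finite box 'I_n.+1 * 'I_n.+1. This box is closed under
   coordinatewise min and max. *)
Definition Qset (n : nat) : {set 'I_n.+1 * 'I_n.+1} :=
  [set p : 'I_n.+1 * 'I_n.+1 | p.1 + p.2 <= n].

Definition pmin (n : nat) (p q : 'I_n.+1 * 'I_n.+1) : 'I_n.+1 * 'I_n.+1 :=
  (Order.min p.1 q.1, Order.min p.2 q.2).

Definition pmax (n : nat) (p q : 'I_n.+1 * 'I_n.+1) : 'I_n.+1 * 'I_n.+1 :=
  (Order.max p.1 q.1, Order.max p.2 q.2).

(* The guard has bound n + 1 while Q(n) has bound n: when the guard holds with
   equality, only the coordinatewise minimum is required to lie in Y. *)
Definition Rset (n : nat) : {set {set 'I_n.+1 * 'I_n.+1}} :=
  [set Y : {set 'I_n.+1 * 'I_n.+1} | (Y \subset Qset n) &&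
    [forall p in Y, forall q in Y,
       ((pmax p q).1 + (pmax p q).2 <= n.+1) ==>
         ((pmin p q \in Y) && ((pmax p q \in Qset n) ==> (pmax p q \in Y)))]].

Definition Rcard (n : nat) : nat := #|Rset n|.

(* Main.v *)
From Stdlib Require Import BinNat Nnat.
Require Import Defs.
From mathcomp Require Import all_boot all_order all_algebra.
From mathcomp Require Import zify lra.

(** Send (x, y) to the interval [x, n - y] of {0, ..., n}: a member of R(n)
    becomes a family of nonempty intervals closed under nonempty intersections
    and under unions of overlapping or adjacent intervals.  Reveal the family
    one left endpoint at a time, from right to left.  The right endpoints still
    usable at some point form a stack of blocks, each a chain in which using an
    element forces all elements further to the right; the next set of right
    endpoints is a union of end segments of the blocks, and all blocks it
    reaches merge into one.  Hence R_n counts walks of length n + 1 on stacks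
    of block sizes.

    For the upper bound, the product of [5 * 2 ^ k - 4] over the block sizes k
    is multiplied by at most 38/3 < 12.75 in one step.  For the lower bound,
    the generating function of the walks diverges at 5/46 < 1/9, which together
    with supermultiplicativity gives growth faster than 9^n.  Divergence is
    seen by recursively bounding below the generating function of the
    excursions above a given block until it exceeds 1. *)

Set Implicit Arguments.
Unset Strict Implicit.
Unset Printing Implicit Defensive.

Import Order.TTheory GRing.Theory Num.Theory.

(** * Walks on stacks of block sizes *)

(* One step either pushes a block of size 1 or chooses j_1, ..., j_t with
   0 <= j_i <= k_i and j_t > 0 from the top t blocks and replaces these by one
   block of size 1 + j_1 + ... + j_t; [J] accumulates the partial sum. *)
Fixpoint merges (J : nat) (ks : seq nat) : seq (seq nat) :=
  if ks is k :: r then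
    flatten [seq (if 0 < j then [:: (J + j).+1 :: r] else [::]) ++
                 merges (J + j) r | j <- iota 0 k.+1]
  else [::].

Definition succs (ks : seq nat) : seq (seq nat) := (1 :: ks) :: merges 0 ks.

Fixpoint walks (n : nat) (ks : seq nat) : nat :=
  if n is m.+1 then \sum_(t <- succs ks) walks m t else 1.

Lemma big_merges (V : nmodType) (f : seq nat -> V) (J k : nat) (r : seq nat) :
  (\sum_(t <- merges J (k :: r)) f t =
   \sum_(0 <= j < k.+1) ((if (0 < j)%N then f ((J + j).+1 :: r) else 0) +
                         \sum_(t <- merges (J + j) r) f t))%R.
Proof.
rewrite /= big_cat big_flatten /= big_map big_nat_recl //= addn0 add0r.
congr (_ + _)%R; rewrite (iotaDl 1 0) big_map /index_iota subn0.
by apply: eq_bigr => j _; rewrite big_cat big_seq1.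
Qed.

Lemma big_merges_split (V : nmodType) (f : seq nat -> V) (J k : nat)
    (r : seq nat) :
  (\sum_(t <- merges J (k :: r)) f t =
   \sum_(0 <= j < k.+1) \sum_(t <- merges (J + j) r) f t +
   \sum_(0 <= j < k) f ((J + j).+2 :: r))%R.
Proof.
rewrite big_merges big_split /= addrC; congr (_ + _)%R.
rewrite big_nat_recl //= add0r.
by apply: eq_bigr => j _; rewrite addnS.
Qed.

(** * Upper bound by a multiplicative weight *)

Fixpoint weight (ks : seq nat) : nat :=
  if ks is k :: r then (5 * 2 ^ k - 4) * weight r else 1.

Lemma weight_gt0 ks : 0 < weight ks.
Proof.
elim: ks => //= k r IH; rewrite muln_gt0 IH andbT subn_gt0.
by have := expn_gt0 2 k; lia.
Qed.

Lemma sum_pow2 k : \sum_(0 <= j < k) 2 ^ j = 2 ^ k - 1.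
Proof.
elim: k => [|k IH]; first by rewrite big_nil.
by rewrite big_nat_recr //= IH expnS; have := expn_gt0 2 k; lia.
Qed.

(* The constants 5, 4 and 20 make the induction step an equality. *)
Lemma weight_merges J ks :
  3 * \sum_(t <- merges J ks) weight t <= 20 * 2 ^ J * weight ks.
Proof.
elim: ks J => [|k r IH] J; first by rewrite big_nil.
rewrite (big_merges_split weight) /GRing.add /= mulnDr.
have H1 : 3 * \sum_(0 <= j < k.+1) \sum_(t <- merges (J + j) r) weight t <=
    20 * 2 ^ J * (2 ^ k.+1 - 1) * weight r.
  rewrite -sum_pow2 big_distrr big_distrr big_distrl /=.
  apply: leq_sum => j _; apply: leq_trans (IH _) _.
  by rewrite expnD !mulnA.
have H2 : 3 * \sum_(0 <= j < k) weight ((J + j).+2 :: r) <=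
    60 * 2 ^ J * (2 ^ k - 1) * weight r.
  rewrite -sum_pow2 big_distrr big_distrr big_distrl /=.
  apply: leq_sum => j _; rewrite !expnS expnD.
  rewrite mulnA leq_mul2r; apply/orP; right; lia.
apply: leq_trans (leq_add H1 H2) _.
rewrite -mulnDl [leqRHS]mulnA leq_mul2r; apply/orP; right.
rewrite expnS; have := expn_gt0 2 k; nia.
Qed.

(** A push contributes the factor 6, the weight of a block of size 1, and the merges contribute
    20/3. *)
Lemma weight_succs ks : 3 * \sum_(t <- succs ks) weight t <= 38 * weight ks.
Proof.
rewrite big_cons mulnDr; have := weight_merges 0 ks.
by rewrite /= expn1 expn0; lia.
Qed.

Lemma walks_upper n ks : 3 ^ n * walks n ks <= 38 ^ n * weight ks.
Proof.
elim: n ks => [|n IH] ks; first by rewrite !mul1n weight_gt0.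
rewrite expnS -mulnA big_distrr /= expnSr -mulnA.
apply: (@leq_trans (38 ^ n * (3 * \sum_(t <- succs ks) weight t))); last first.
  by rewrite leq_mul2l weight_succs orbT.
rewrite mulnCA leq_mul2l big_distrr /=.
by apply: leq_sum => t _; exact: IH.
Qed.

(** * Monotonicity and supermultiplicativity of walk counts *)

Fixpoint dominates (s t : seq nat) {struct t} : bool :=
  match t, s with
  | [::], _ => true
  | l :: t', k :: s' => (l <= k) && dominates s' t'
  | _, _ => false
  end.

(** The choices possible in [t] are also possible in [s], where they lead to a dominating stack;
    hence the sums over j are cut at the smaller block size. *)
Lemma merges_dominates (f : seq nat -> nat) (J J' : nat) (s t : seq nat) :
  (forall s t, dominates s t -> f t <= f s) -> dominates s t -> J <= J' ->
  \sum_(u <- merges J t) f u <= \sum_(u <- merges J' s) f u.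
Proof.
move=> fP; elim: t s J J' => [|l t IH] [|k s] J J' // dom leJ.
- by rewrite big_nil.
case/andP: dom => lek dom.
rewrite !(big_merges_split f) /GRing.add /=.
apply: leq_add.
  rewrite (big_cat_nat (n := l.+1) (p := k.+1)) //= -[leqLHS]addn0 leq_add //.
  by apply: leq_sum => j _; apply: IH => //; rewrite leq_add2r.
rewrite (big_cat_nat (n := l) (p := k)) //= -[leqLHS]addn0 leq_add //.
by apply: leq_sum => j _; apply: fP; rewrite /= !ltnS leq_add2r leJ.
Qed.

Lemma walks_dominates n s t : dominates s t -> walks n t <= walks n s.
Proof.
elim: n s t => //= n IH s t dom; rewrite !big_cons leq_add //.
  exact: (IH (_ :: _) (_ :: _)).
exact: merges_dominates.
Qed.

Lemma merges_dom1 J ks t : t \in merges J ks -> dominates t [:: 1].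
Proof.
elim: ks J => //= k r IH J.
rewrite mem_cat => /orP [/IH //|/flattenP [u /mapP [j _ ->]]].
rewrite mem_cat => /orP []; last exact: IH.
by case: ifP => // _; rewrite mem_seq1 => /eqP ->.
Qed.

(** The top block never becomes empty, so the stack reached after [m] steps dominates [[:: 1]]. *)
Lemma walks_supermul m n s :
  dominates s [:: 1] -> walks m s * walks n [:: 1] <= walks (m + n) s.
Proof.
elim: m s => [|m IH] s dom; first by rewrite mul1n; exact: walks_dominates.
rewrite addSn [walks _ s]/= [leqRHS]/= big_distrl /=.
rewrite [leqLHS]big_seq [leqRHS]big_seq; apply: leq_sum => t.
by rewrite inE => /orP [/eqP ->|/merges_dom1 dom1]; apply: IH.
Qed.

Lemma walks_gt0 n s : 0 < walks n s.
Proof. by elim: n s => //= n IH s; rewrite big_cons ltn_addr. Qed.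

(** * Sets of right endpoints *)

(* An interval [n - m, n - y] is recorded as y in the m-th set.  A history lists
   these sets, the latest first, each in decreasing order of y, so that the
   right endpoints increase along a block. *)
Fixpoint tails (L : seq nat) : seq (seq nat) :=
  if L is _ :: L' then L :: tails L' else [:: [::]].

Fixpoint choices (s : seq (seq nat)) : seq (seq nat) :=
  if s is L :: s' then [seq T ++ A | T <- tails L, A <- choices s']
  else [:: [::]].

(** Here [m] records the right endpoint of the singleton at the next left endpoint. It heads the
    block of [A] because, by adjacency, using it forces all of [A]. The filter keeps the blocks
    below the lowest one reached. *)
Definition next (m : nat) (A : seq nat) (s : seq (seq nat)) : seq (seq nat) :=
  if A is [::] then [:: m] :: s
  else (m :: A) :: [seq L <- s | last 0 L < last 0 A].

Fixpoint stack_of (h : seq (seq nat)) : seq (seq nat) :=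
  if h is A :: h' then next (size h) A (stack_of h') else [:: [:: 0]].

Fixpoint histories (k : nat) : seq (seq (seq nat)) :=
  if k is k'.+1
  then [seq A :: h | h <- histories k', A <- choices (stack_of h)]
  else [:: [::]].

Definition wf (s : seq (seq nat)) : bool :=
  pairwise gtn (flatten s) && ([::] \notin s).

(** Up means towards larger right endpoints, that is, smaller recorded values. *)
Definition upclosed (P : pred nat) (L : seq nat) : Prop :=
  forall b d, b \in L -> d \in L -> d < b -> P b -> P d.

Definition good (s : seq (seq nat)) (P : pred nat) : Prop :=
  (forall b, P b -> b \in flatten s) /\ (forall L, L \in s -> upclosed P L).

Lemma mem_tails_last L T : T \in tails L -> T != [::] -> last 0 T = last 0 L.
Proof.
elim: L => [|x L IH] /=; first by rewrite mem_seq1 => ->.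
rewrite inE => /orP [/eqP -> //|T_in T_n0].
by rewrite (IH T_in T_n0); case: L T_in {IH} => //=; rewrite mem_seq1 (negPf T_n0).
Qed.

Lemma tails_suffix L T : T \in tails L -> exists U, L = U ++ T.
Proof.
elim: L => [|x L IH] /=; first by rewrite mem_seq1 => /eqP ->; exists [::].
rewrite inE => /orP [/eqP ->|/IH [U ->]]; first by exists [::].
by exists (x :: U).
Qed.

Lemma tails_uniq L : uniq (tails L).
Proof.
elim: L => //= x L ->; rewrite andbT; apply/negP => /tails_suffix [U].
by move/(congr1 size); rewrite size_cat /=; lia.
Qed.

Lemma choices_subset s A : A \in choices s -> {subset A <= flatten s}.
Proof.
elim: s A => [|L s IH] A /=; first by rewrite mem_seq1 => /eqP ->.
move=> /allpairsP [[T A'] /= [/tails_suffix [U ->] /IH sub ->]] x.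
rewrite !mem_cat => /orP [->|/sub ->]; first by rewrite orbT.
by rewrite !orbT.
Qed.

Lemma filter_tails (P : pred nat) L :
  pairwise gtn L -> upclosed P L -> filter P L \in tails L.
Proof.
elim: L => //= x L IH /andP [/allP gt_x pw] up.
have upL : upclosed P L.
  by move=> b d bL dL; apply: up; rewrite inE ?bL ?dL orbT.
case: ifP => Px; last by rewrite inE IH ?orbT.
suff /all_filterP -> : all P L by rewrite inE eqxx.
apply/allP => y yL; apply: (up x) => //; rewrite ?inE ?eqxx ?yL ?orbT //.
exact: gt_x.
Qed.

Lemma filter_choices (P : pred nat) s : pairwise gtn (flatten s) ->
  (forall L, L \in s -> upclosed P L) -> filter P (flatten s) \in choices s.
Proof.
elim: s => //= L s IH; rewrite pairwise_cat => /and3P [_ pwL pws] up.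
rewrite filter_cat; apply/allpairsP.
exists (filter P L, filter P (flatten s)); split=> //=.
  by apply: filter_tails => //; apply: up; rewrite mem_head.
by apply: IH => // M Ms; apply: up; rewrite inE Ms orbT.
Qed.

Lemma choices_pairwise s A :
  pairwise gtn (flatten s) -> A \in choices s -> pairwise gtn A.
Proof.
elim: s A => [|L s IH] A /=; first by rewrite mem_seq1 => _ /eqP ->.
rewrite pairwise_cat => /and3P [rel pwL pws].
move=> /allpairsP [[T A'] /= [/tails_suffix [U defL] A'_in ->]].
move: pwL; rewrite defL !pairwise_cat => /and3P [_ _ ->].
rewrite (IH _ pws A'_in) !andbT; apply/allrelP => x y xT /(choices_subset A'_in).
by move/allrelP: rel => rel; apply: rel; rewrite defL mem_cat xT orbT.
Qed.

Lemma flatten_disjoint L s x :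
  pairwise gtn (flatten (L :: s)) -> x \in L -> x \notin flatten s.
Proof.
rewrite /= pairwise_cat => /and3P [/allrelP rel _ _] xL.
by apply/negP => /(rel _ _ xL); rewrite /= ltnn.
Qed.

Lemma choices_good s A :
  pairwise gtn (flatten s) -> A \in choices s -> good s (mem A).
Proof.
move=> pw A_in; split; first by move=> b; exact: choices_subset.
elim: s A pw A_in => //= L s IH A pw.
have disj := flatten_disjoint pw.
move: pw; rewrite pairwise_cat => /and3P [rel pwL pws].
move=> /allpairsP [[T A'] /= [/tails_suffix [U defL] A'_in ->]] M.
rewrite inE => /orP [/eqP ->|Ms] b d.
  move=> bL dL lt_db /=; rewrite !mem_cat => /orP [bT|bA']; last first.
    by have := disj _ bL; rewrite (choices_subset A'_in bA').
  move: dL; rewrite defL mem_cat => /orP [dU|->//].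
  move: pwL; rewrite defL pairwise_cat => /and3P [/allrelP relU _ _].
  by have := relU _ _ dU bT; rewrite /= ltnNge ltnW.
move=> bM dM lt_db /=; rewrite !mem_cat => /orP [bT|bA'].
  have /disj/negP [] : b \in L by rewrite defL mem_cat bT orbT.
  by apply/flattenP; exists M.
suff -> : d \in A' by rewrite orbT.
exact: (IH A' pws A'_in M Ms b d).
Qed.

Lemma pairwise_gtn_eq (A B : seq nat) :
  pairwise gtn A -> pairwise gtn B -> A =i B -> A = B.
Proof.
have tr : transitive gtn by move=> x y z /= xy yz; exact: ltn_trans yz xy.
rewrite -!sorted_pairwise // => sA sB.
by apply: (irr_sorted_eq tr) => // x; rewrite /= ltnn.
Qed.

Lemma mem_choices s A : pairwise gtn (flatten s) ->
  A \in choices s <-> pairwise gtn A /\ good s (mem A).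
Proof.
move=> pw; split=> [A_in|[pwA [sub up]]].
  by split; [exact: choices_pairwise A_in | exact: choices_good].
suff -> : A = filter (mem A) (flatten s) by exact: filter_choices.
apply: pairwise_gtn_eq => //; first exact: pairwise_filter.
by move=> x; rewrite mem_filter /=; case: (boolP (x \in A)) => //= /sub ->.
Qed.

Lemma choices_uniq s : pairwise gtn (flatten s) -> uniq (choices s).
Proof.
elim: s => //= L s IH pw; have disj := flatten_disjoint pw.
move: pw; rewrite pairwise_cat => /and3P [_ _ /IH uq].
apply: allpairs_uniq => //; first exact: tails_uniq.
(* Blocks are disjoint, so filtering recovers the part of a choice taken from [L]. *)
have key T A : T \in tails L -> A \in choices s ->
    [seq x <- T ++ A | x \in L] = T.
  move=> /tails_suffix [U defL] A_in; rewrite filter_cat.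
  have /all_filterP -> : all (mem L) T.
    by apply/allP => x xT; rewrite /= defL mem_cat xT orbT.
  rewrite (eq_in_filter (a2 := pred0)) ?filter_pred0 ?cats0 // => x xA.
  by apply/negP => /disj /negP []; exact: choices_subset xA.
move=> p q /allpairsP [[T A] /= [T_in A_in ->]].
move=> /allpairsP [[T' A'] /= [T'_in A'_in ->]] /= eq_cat.
have eqT : T = T' by rewrite -(key T A) // eq_cat key.
by move: eq_cat; rewrite eqT => /eqP; rewrite eqseq_cat // eqxx /= => /eqP ->.
Qed.

(** * Counting choices by block sizes *)

Lemma sum_tails (f : nat -> nat) L :
  \sum_(T <- tails L) f (size T) = \sum_(0 <= j < (size L).+1) f j.
Proof.
elim: L => [|x L IH]; first by rewrite big_seq1 big_nat1.
by rewrite big_nat_recr //= big_cons IH addnC.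
Qed.

(* The value [c] at the empty choice is arbitrary: in the induction it is the
   contribution of choices that stop in the blocks already passed. *)
Lemma sum_choices_merges (f : seq nat -> nat) c J s : wf s ->
  \sum_(A <- choices s)
    (if A is [::] then c
     else f ((J + size A).+1 :: map size [seq L <- s | last 0 L < last 0 A])) =
  c + \sum_(t <- merges J (map size s)) f t.
Proof.
elim: s J c => [|L s IH] J c; first by rewrite big_seq1 big_nil addn0.
case/andP; rewrite inE negb_or => pw /andP [L0 s0].
have := pw; rewrite /= pairwise_cat => /and3P [/allrelP rel _ pws].
have wfs : wf s by rewrite /wf pws.
have last_in (M : seq nat) : M != [::] -> last 0 M \in M.
  by case: M => // x M _; exact: mem_last.
have lastL : last 0 L \in L by apply: last_in; rewrite eq_sym.
have last_s M : M \in s -> last 0 M < last 0 L.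
  move=> Ms; apply: rel lastL _; apply/flattenP; exists M => //; apply: last_in.
  by apply: contraNneq s0 => <-.
rewrite big_allpairs_dep.
have -> : \sum_(t <- merges J (map size (L :: s))) f t =
    \sum_(0 <= j < (size L).+1)
      ((if 0 < j then f ((J + j).+1 :: map size s) else 0) +
       \sum_(t <- merges (J + j) (map size s)) f t) by exact: big_merges.
pose H j := (if 0 < j then f ((J + j).+1 :: map size s) else c) +
            \sum_(t <- merges (J + j) (map size s)) f t.
transitivity (\sum_(T <- tails L) H (size T)); last first.
  by rewrite sum_tails /H !big_nat_recl // add0n addnA.
rewrite big_seq [RHS]big_seq; apply: eq_bigr => T T_in.
rewrite /H -IH // big_seq [RHS]big_seq; apply: eq_bigr => A A_in.
case: A A_in => [|a A] A_in; last first.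
  have lt_last : last a A < last 0 L.
    by apply: rel lastL _; apply: (choices_subset A_in); rewrite mem_last.
  have nlt : (last 0 L < last a A) = false by rewrite ltnNge ltnW.
  case: T T_in => [|x T] _ /=; rewrite ?last_cat /= nlt ?addn0 //.
  by rewrite size_cat /= -addnA.
rewrite cats0; case: T T_in => [//|x T T_in].
rewrite (mem_tails_last T_in) //= ltnn.
by congr (f (_ :: map size _)); apply/all_filterP/allP => M /last_s.
Qed.

Lemma sum_choices (f : seq nat -> nat) m s : wf s ->
  \sum_(A <- choices s) f (map size (next m A s)) =
  \sum_(t <- succs (map size s)) f t.
Proof.
move=> wfs; rewrite big_cons -(sum_choices_merges f _ 0 wfs).
by apply: eq_bigr => -[|a A] _.
Qed.

(** * Valid histories and their stacks *)

(* Closure of the family under the operations applied to an interval from the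
   i-th set [D] and one from a later set [P]. *)
Definition linked (i : nat) (D : seq nat) (P : pred nat) : Prop :=
  forall b d, P b -> d \in D -> d < b -> b <= i.+1 ->
    P d /\ (b <= i -> b \in D).

Fixpoint compat (h : seq (seq nat)) (P : pred nat) : Prop :=
  if h is D :: h' then
    linked (size h') D P /\ compat h' P
  else True.

Fixpoint valid (h : seq (seq nat)) : Prop :=
  if h is A :: h' then
    [/\ valid h', pairwise gtn A, forall b, b \in A -> b <= size h'
       & compat h' (mem A)]
  else True.

Lemma eq_compat h (P Q : pred nat) :
  (forall b, b <= size h -> P b = Q b) -> compat h P -> compat h Q.
Proof.
elim: h => //= D h IH eqPQ [ok com]; split; last first.
  by apply: IH com => b le_b; apply: eqPQ; exact: ltnW.
move=> b d Qb dD lt_db le_b.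
have [|Pd bD] := ok b d _ dD lt_db le_b; first by rewrite eqPQ.
by rewrite -eqPQ // (leq_trans (ltnW lt_db)).
Qed.

Lemma last_gtn_min M x : pairwise gtn M -> x \in M -> last 0 M <= x.
Proof.
case/lastP: M => // M y; rewrite pairwise_rcons last_rcons mem_rcons inE.
by move=> /andP [/allP lt_y _] /orP [/eqP -> //|/lt_y /ltnW].
Qed.

Lemma next_nonempty m A s : A != [::] ->
  next m A s = (m :: A) :: [seq L <- s | last 0 L < last 0 A].
Proof. by case: A. Qed.

(** The block [L] containing [last 0 A] has the same last element, since [A] is upclosed in it. It
    separates the absorbed blocks from the surviving ones [s2]. *)
Lemma next_split s A : wf s -> good s (mem A) -> pairwise gtn A -> A != [::] ->
  exists s1 L s2, [/\ s = s1 ++ L :: s2,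
    [seq M <- s | last 0 M < last 0 A] = s2,
    forall x, x \in flatten s1 ++ L -> last 0 A <= x
    & forall x, x \in flatten s2 -> x < last 0 A].
Proof.
case/andP => pw s0 [sub up] pwA A0.
have last_in (M : seq nat) : M != [::] -> last 0 M \in M.
  by case: M => // x M _; exact: mem_last.
set z := last 0 A; have zA : z \in A by exact: last_in.
have /flattenP [L Ls zL] := sub z zA.
have L0 : L != [::] by apply: contraNneq s0 => <-.
have upL := up L Ls; case/splitPr: Ls {sub up} pw s0 => s1 s2.
rewrite flatten_cat /= !pairwise_cat => /and3P [/allrelP rel1 _].
case/and3P => [/allrelP rel2 pwL _]; rewrite mem_cat inE !negb_or.
case/and3P => s1_0 _ s2_0.
have lastL : last 0 L = z.
  apply/eqP; rewrite eqn_leq last_gtn_min // leqNgt; apply/negP => lt_z.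
  have := upL z (last 0 L) zL (last_in _ L0) lt_z zA.
  by move=> /(last_gtn_min pwA); rewrite leqNgt lt_z.
exists s1, L, s2; split=> //.
- rewrite filter_cat /= lastL ltnn (eq_in_filter (a2 := pred0)) => [|M Ms].
    rewrite filter_pred0; apply/all_filterP/allP => M Ms.
    apply: rel2 zL _; apply/flattenP; exists M => //; apply: last_in.
    by apply: contraNneq s2_0 => <-.
  apply/negbTE; rewrite -leqNgt ltnW //; apply: (rel1 (last 0 M) z).
    apply/flattenP; exists M => //; apply: last_in.
    by apply: contraNneq s1_0 => <-.
  by rewrite mem_cat zL.
- move=> x; rewrite mem_cat => /orP [x1|xL]; last by rewrite -lastL last_gtn_min.
  by apply/ltnW/(rel1 x z) => //; rewrite mem_cat zL.
- by move=> x; exact: rel2.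
Qed.

(** The stack summarizes all constraints from the past: being closed with respect to every earlier
    set amounts to being a union of end segments of the current blocks. *)
Lemma stack_ofP h : valid h ->
  [/\ wf (stack_of h), forall x, x \in flatten (stack_of h) -> x <= size h
    & forall P : pred nat, (forall b, P b -> b <= size h) ->
        compat h P <-> good (stack_of h) P].
Proof.
elim: h => [_|A h IH] /=.
  split=> // [x|P leP]; first by rewrite mem_seq1 => /eqP ->.
  split=> // _; split=> [b|L]; first by move/leP; rewrite mem_seq1 leqn0.
  by rewrite mem_seq1 => /eqP -> b d; rewrite !mem_seq1 => /eqP -> /eqP ->.
case=> /IH [wfs le_s compatE] pwA leA /compatE goodA.
have {}goodA := goodA leA; set s := stack_of h in wfs le_s compatE goodA *.
set m := size h in le_s compatE leA *.
(* The value [m.+1] has just become usable and is invisible to the sets in [h], so the induction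
   hypothesis is applied to [P] restricted to values up to [m]. *)
have cut (P : pred nat) : (forall b, P b -> b <= m.+1) ->
    compat h P <-> good s (fun b => P b && (b <= m)).
  move=> leP; rewrite -compatE => [|b /andP [] //].
  by split; apply: eq_compat => b; rewrite -/m => le_b; rewrite le_b andbT.
case: (eqVneq A [::]) goodA pwA leA => [-> _ _ _|A0 goodA pwA leA].
  split.
  - case/andP: wfs => pw s0; rewrite /wf /= pw inE s0 !andbT.
    by apply/allP => x /le_s; rewrite /= ltnS.
  - by move=> x; rewrite /= inE => /orP [/eqP -> //|/le_s /leqW].
  move=> P leP; rewrite cut //; split=> [[_ [sub up]]|[sub up]].
    split=> [b Pb|L] /=.
      rewrite inE; case: eqP => //= ne_b; apply: sub.
      by rewrite Pb /=; have := leP b Pb; lia.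
    rewrite inE => /orP [/eqP -> b d|Ls b d bL dL lt_db Pb].
      by rewrite !mem_seq1 => /eqP -> /eqP ->; rewrite ltnn.
    have le_b : b <= m by apply: le_s; apply/flattenP; exists L.
    have := up L Ls b d bL dL lt_db; rewrite Pb le_b => /(_ isT).
    by case/andP.
  split=> //; split=> [b /andP [Pb le_b]|L Ls b d bL dL lt_db /andP [Pb le_b]].
    have := sub b Pb; rewrite /= inE => /orP [/eqP eq_b|//].
    by rewrite eq_b ltnn in le_b.
  rewrite (up L _ b d) ?inE ?Ls ?orbT //=.
  exact: leq_trans (ltnW lt_db) le_b.
have [s1 [L [s2 [defs rest ge_z lt_z]]]] := next_split wfs goodA pwA A0.
rewrite next_nonempty // rest; set z := last 0 A in ge_z lt_z *.
have zA : z \in A by rewrite /z; case: (A) A0 => // a A' _; exact: mem_last.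
have z_min x : x \in A -> z <= x by exact: last_gtn_min.
have mem_s x : x \in flatten s = (x \in flatten s1 ++ L) || (x \in flatten s2).
  by rewrite defs flatten_cat /= !mem_cat orbA.
split.
- rewrite /wf /= pairwise_cat pwA inE; apply/andP; split.
  + apply/andP; split.
      apply/allP => x; rewrite mem_cat => /orP [/leA|x2]; rewrite /= ltnS //.
      by apply: le_s; rewrite mem_s x2 orbT.
    rewrite /=; move: wfs => /andP []; rewrite defs flatten_cat /= !pairwise_cat.
    case/and3P => _ _ /and3P [_ _ ->] _; rewrite andbT.
    by apply/allrelP => x y /z_min le_zx /lt_z lt_yz; exact: leq_trans lt_yz le_zx.
  + move: wfs => /andP [_]; rewrite defs mem_cat inE !negb_or.
    by case/and3P.
- move=> x; rewrite /= inE mem_cat => /or3P [/eqP -> //|/leA /leqW //|x2].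
  by apply/leqW/le_s; rewrite mem_s x2 orbT.
(* The link with z puts every b of [P] with z < b <= m into [A]; this is why the other values above
   z are lost. *)
move=> P leP; rewrite cut //; split=> [[ok [sub up]]|[sub up]].
  split=> [b Pb|M] /=.
    rewrite inE mem_cat; case: (ltnP b m.+1) => [le_b|]; last first.
      by have := leP b Pb => ? ?; rewrite (_ : b = m.+1) ?eqxx //; lia.
    have := sub b; rewrite Pb -ltnS le_b mem_s => /(_ isT) /orP [/ge_z le_zb|->].
      suff -> : b \in A by rewrite orbT.
      move: le_zb; rewrite leq_eqVlt => /orP [/eqP <- //|lt_zb].
      by have [_] := ok b z Pb zA lt_zb (leqW le_b); apply.
    by rewrite !orbT.
  rewrite inE => /orP [/eqP -> b d bL dL lt_db Pb|M2 b d bM dM lt_db Pb].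
    have dA : d \in A.
      move: dL; rewrite inE => /orP [/eqP eq_d|//].
      by have := leP b Pb; rewrite -eq_d leqNgt lt_db.
    by have [] := ok b d Pb dA lt_db (leP b Pb).
  have Ms : M \in s by rewrite defs mem_cat inE M2 !orbT.
  have le_b : b <= m by apply: le_s; apply/flattenP; exists M.
  have := up M Ms b d bM dM lt_db; rewrite Pb le_b => /(_ isT).
  by case/andP.
have in_A b : P b -> b <= m -> z <= b -> b \in A.
  move=> Pb le_b le_zb; have := sub b Pb; rewrite /= inE mem_cat.
  case/or3P => [/eqP eq_b|//|/lt_z]; last by rewrite ltnNge le_zb.
  by rewrite eq_b ltnn in le_b.
split=> [b d Pb dA lt_db le_b|].
  split=> [|le_bm]; last by apply: in_A => //; exact: leq_trans (z_min _ dA) (ltnW lt_db).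
  apply: (up (m.+1 :: A) (mem_head _ _) b d) => //; last by rewrite inE dA orbT.
  rewrite inE; case: (eqVneq b m.+1) => //= ne_b; apply: in_A => //; first by lia.
  exact: leq_trans (z_min _ dA) (ltnW lt_db).
have [subA upA] := goodA.
split=> [b /andP [Pb le_b]|M Ms b d bM dM lt_db /andP [Pb le_b]].
  have := sub b Pb; rewrite /= inE mem_cat => /or3P [/eqP eq_b|bA|b2].
  - by rewrite eq_b ltnn in le_b.
  - exact: subA.
  - by rewrite mem_s b2 orbT.
rewrite (leq_trans (ltnW lt_db) le_b) andbT.
have [M2|M1] : M \in s2 \/ {subset M <= flatten s1 ++ L}.
- move: Ms; rewrite defs mem_cat inE => /or3P [M1|/eqP ->|]; [right|right|by left].
    by move=> x xM; rewrite mem_cat; apply/orP; left; apply/flattenP; exists M.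
  by move=> x xL; rewrite mem_cat xL orbT.
- by apply: (up M _ b d) => //; rewrite inE M2 orbT.
have bA : b \in A by apply: in_A => //; exact/ge_z/M1.
have dA : d \in A by exact: upA bM dM lt_db bA.
by apply: (up (m.+1 :: A) (mem_head _ _) b d) => //; rewrite inE ?bA ?dA orbT.
Qed.

Lemma mem_histories k h : h \in histories k <-> size h = k /\ valid h.
Proof.
elim: k h => [|k IH] h; first by rewrite mem_seq1; case: h => [|A h]; split=> // -[].
split=> [/allpairsPdep [h' [A [/IH [szh' vh'] A_in ->]]] | [szh vh]].
  have [/andP [pw _] le_s compatE] := stack_ofP vh'.
  have [pwA goodA] := (mem_choices A pw).1 A_in.
  have leA b : b \in A -> b <= size h' by move=> /(proj1 goodA) /le_s.
  split=> /=; first by rewrite szh'.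
  by split=> //; apply/compatE.
case: h szh vh => // A h [szh] /= [vh pwA leA comA].
have [/andP [pw _] _ compatE] := stack_ofP vh.
apply/allpairsPdep; exists h, A; split=> //; first exact/IH.
by apply/mem_choices => //; split=> //; apply/compatE.
Qed.

Lemma histories_uniq k : uniq (histories k).
Proof.
elim: k => //= k IH; apply: allpairs_uniq_dep => //.
  move=> h /mem_histories [_ /stack_ofP [/andP [pw _] _ _]].
  exact: choices_uniq.
by move=> [h A] [h' A'] _ _ /= [-> ->].
Qed.

(** Extending a history by a choice is one step of the walk on the block sizes of its stack, so
    steps move one by one from the walk to the history. *)
Lemma sum_histories k m :
  \sum_(h <- histories k) walks m (map size (stack_of h)) = walks (k + m) [:: 1].
Proof.
elim: k m => [|k IH] m; first by rewrite big_seq1.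
rewrite addSnnS -IH /= big_allpairs_dep big_seq [RHS]big_seq.
apply: eq_bigr => h /mem_histories [_ /stack_ofP [wfs _ _]].
exact: sum_choices.
Qed.

Lemma size_histories k : size (histories k) = walks k [:: 1].
Proof. by rewrite -(addn0 k) -sum_histories sum1_size addn0. Qed.

(** * Encoding members of R(n) as histories *)

Fixpoint record (c : nat -> seq nat) (k : nat) : seq (seq nat) :=
  if k is k'.+1 then c k' :: record c k' else [::].

Lemma size_record c k : size (record c k) = k.
Proof. by elim: k => //= k ->. Qed.

Lemma eq_record c c' k : (forall i, i < k -> c i = c' i) -> record c k = record c' k.
Proof.
elim: k => //= k IH eq_c; rewrite eq_c // IH // => i /ltnW; exact: eq_c.
Qed.

Lemma record_inj c c' k i : record c k = record c' k -> i < k -> c i = c' i.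
Proof.
elim: k => //= k IH [eq_k /IH eq_i]; rewrite ltnS leq_eqVlt.
by case/orP => [/eqP ->|/eq_i].
Qed.

Lemma record_surj h : exists c, h = record c (size h).
Proof.
elim: h => [|A h [c def_h]]; first by exists (fun=> [::]).
exists (fun i => if i == size h then A else c i); rewrite /= eqxx; congr (_ :: _).
by rewrite {1}def_h; apply: eq_record => i lt_i; rewrite ltn_eqF.
Qed.

Lemma compat_record c k j :
  compat (record c k) (mem (c j)) <-> (forall i, i < k -> linked i (c i) (mem (c j))).
Proof.
elim: k => //= k IH; rewrite size_record; split=> [[ok /IH com] i|ok].
  by rewrite ltnS leq_eqVlt => /orP [/eqP ->|/com].
by split; [exact: ok | apply/IH => i /leqW; exact: ok].
Qed.

Lemma valid_record c k : valid (record c k) <->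
  forall j, j < k -> [/\ pairwise gtn (c j), forall b, b \in c j -> b <= j
    & forall i, i < j -> linked i (c i) (mem (c j))].
Proof.
elim: k => //= k IH; rewrite size_record; split.
  case=> /IH val pw le_c /compat_record com j.
  by rewrite ltnS leq_eqVlt => /orP [/eqP -> //|/val].
move=> val; have [pw le_c com] := val k (ltnSn k).
by split=> //; [apply/IH => j /leqW; exact: val | apply/compat_record].
Qed.

Definition column (n : nat) (Y : {set 'I_n.+1 * 'I_n.+1}) (m : nat) : seq nat :=
  [seq y <- rev (iota 0 m.+1) | (inord (n - m), inord y) \in Y].

Lemma mem_column n (Y : {set 'I_n.+1 * 'I_n.+1}) m y :
  (y \in column Y m) = (y <= m) && ((inord (n - m), inord y) \in Y).
Proof. by rewrite mem_filter mem_rev mem_iota add0n ltnS andbC. Qed.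

Lemma column_pairwise n (Y : {set 'I_n.+1 * 'I_n.+1}) m :
  pairwise gtn (column Y m).
Proof.
have tr : transitive gtn by move=> x y z /= xy yz; exact: ltn_trans yz xy.
apply: pairwise_filter; rewrite -sorted_pairwise // rev_sorted.
exact: iota_ltn_sorted.
Qed.

Lemma in_column n (Y : {set 'I_n.+1 * 'I_n.+1}) p : Y \subset Qset n ->
  (p \in Y) = (nat_of_ord p.2 \in column Y (n - p.1)).
Proof.
move=> sub; rewrite mem_column subKn ?inord_val; last by rewrite -ltnS.
rewrite -surjective_pairing; apply/idP/andP => [pY|[]//]; split=> //.
have := subsetP sub p pY; rewrite inE => le_n.
by rewrite leq_subRL // (leq_trans (leq_addr _ _) le_n).
Qed.

Lemma pminmax_le n (p q : 'I_n.+1 * 'I_n.+1) : p.1 <= q.1 ->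
  (p.2 <= q.2 -> pmin p q = p /\ pmax p q = q) /\
  (q.2 <= p.2 -> pmin p q = (p.1, q.2) /\ pmax p q = (q.1, p.2)).
Proof.
rewrite /pmin /pmax => le1; have le1' : (p.1 <= q.1)%O by rewrite leEord.
rewrite (min_l le1') (max_r le1'); split=> le2.
  have le2' : (p.2 <= q.2)%O by rewrite leEord.
  by rewrite (min_l le2') (max_r le2') -!surjective_pairing.
have le2' : (q.2 <= p.2)%O by rewrite leEord.
by rewrite (min_r le2') (max_l le2').
Qed.

Lemma pminC n (p q : 'I_n.+1 * 'I_n.+1) : pmin p q = pmin q p.
Proof. by rewrite /pmin minC [Order.min p.2 _]minC. Qed.

Lemma pmaxC n (p q : 'I_n.+1 * 'I_n.+1) : pmax p q = pmax q p.
Proof. by rewrite /pmax maxC [Order.max p.2 _]maxC. Qed.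

(** Only pairs that are incomparable coordinatewise impose a condition. For d in column i and b in
    column j with i < j and d < b, the maximum is (n - i, b): the guard reads b <= i + 1, and lying
    in Q(n) reads b <= i. *)
Lemma in_Rset n (Y : {set 'I_n.+1 * 'I_n.+1}) :
  Y \in Rset n <-> Y \subset Qset n /\
    (forall i j, i < j -> j <= n -> linked i (column Y i) (mem (column Y j))).
Proof.
rewrite inE; split=> [/andP [sub /forall_inP cl]|[sub link]].
  split=> // i j lt_ij le_jn b d; rewrite /= !mem_column.
  move=> /andP [le_bj bY] /andP [le_di dY] lt_db le_bi.
  have /forall_inP /(_ _ dY) := cl _ bY.
  set p := (inord (n - j), inord b); set q := (inord (n - i), inord d).
  have valp1 : p.1 = n - j :> nat by rewrite inordK // ltnS leq_subr.
  have valq1 : q.1 = n - i :> nat by rewrite inordK // ltnS leq_subr.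
  have valp2 : p.2 = b :> nat by rewrite inordK //; lia.
  have valq2 : q.2 = d :> nat by rewrite inordK //; lia.
  have le1 : p.1 <= q.1 by rewrite valp1 valq1 leq_sub2l // ltnW.
  have le2 : q.2 <= p.2 by rewrite valp2 valq2 ltnW.
  have [-> ->] := (pminmax_le le1).2 le2; rewrite /= inE /= valq1 valp2.
  have -> : n - i + b <= n.+1 by lia.
  case/andP => minY /implyP maxY.
  split=> [|le_b]; first by rewrite minY andbT; lia.
  by rewrite le_b; apply: maxY; lia.
rewrite sub; apply/forall_inP => p pY; apply/forall_inP => q qY; apply/implyP.
wlog le1 : p q pY qY / p.1 <= q.1.
  move=> wl; case: (leqP p.1 q.1) => [|/ltnW] le1; first exact: wl.
  by rewrite pminC pmaxC; apply: wl.
case: (leqP p.2 q.2) => [le2|lt2].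
  by have [-> ->] := (pminmax_le le1).1 le2; rewrite pY qY implybT.
have [-> ->] := (pminmax_le le1).2 (ltnW lt2); rewrite [_.1]/= [_.2]/= => le_n.
have [eq1|ne1] := eqVneq p.1 q.1.
  have -> : (p.1, q.2) = q by rewrite eq1 -surjective_pairing.
  have -> : (q.1, p.2) = p by rewrite -eq1 -surjective_pairing.
  by rewrite qY pY implybT.
have lt1 : p.1 < q.1 by rewrite ltn_neqAle ne1.
have le_q1 : q.1 <= n by rewrite -ltnS.
have lt_ij : n - q.1 < n - p.1 by rewrite ltn_sub2l // (leq_trans lt1).
have le_b : p.2 <= (n - q.1).+1 by rewrite -subSn // leq_subRL // leqW.
have p_col : nat_of_ord p.2 \in column Y (n - p.1) by rewrite -in_column.
have q_col : nat_of_ord q.2 \in column Y (n - q.1) by rewrite -in_column.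
have [minY maxY] := link _ _ lt_ij (leq_subr _ _) _ _ p_col q_col lt2 le_b.
rewrite /= in minY.
rewrite (in_column (p.1, q.2)) // minY; apply/implyP; rewrite inE /= => le_max.
by rewrite (in_column (q.1, p.2)) //= maxY // leq_subRL.
Qed.

Lemma Rcard_walks n : Rcard n = walks n.+1 [:: 1].
Proof.
rewrite -size_histories /Rcard cardE.
pose code (Y : {set 'I_n.+1 * 'I_n.+1}) := record (column Y) n.+1.
rewrite -(size_map code); apply/perm_size/uniq_perm; last 1 first.
- move=> h; apply/mapP/idP => [[Y]|/mem_histories [szh vh]].
    rewrite mem_enum => /in_Rset [sub link] ->; apply/mem_histories.
    rewrite size_record; split=> //; apply/valid_record => j lt_j.
    split=> [|b|i lt_ij]; [exact: column_pairwise | | exact: link].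
    by rewrite mem_column => /andP [].
  have [c def_h] := record_surj h; rewrite szh in def_h.
  move: vh; rewrite def_h => /valid_record val.
  (* The inverse of the encoding. *)
  pose Y : {set 'I_n.+1 * 'I_n.+1} :=
    [set p | nat_of_ord p.2 \in c (n - nat_of_ord p.1)].
  have eq_col i : i < n.+1 -> column Y i = c i.
    move=> lt_i; have [pw le_c _] := val i lt_i.
    apply: pairwise_gtn_eq => //; first exact: column_pairwise.
    move=> y; rewrite mem_column; case: (leqP y i) => [le_y|lt_y] /=.
      rewrite inE /= !inordK ?ltnS ?leq_subr //; last exact: leq_trans le_y _.
      by rewrite subKn.
    by apply/esym/negbTE/negP => /le_c; rewrite leqNgt lt_y.
  exists Y; last by symmetry; exact: eq_record.
  rewrite mem_enum; apply/in_Rset; split.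
    apply/subsetP => p; rewrite !inE.
    have [|_ le_c _] := val (n - p.1); first by rewrite ltnS leq_subr.
    by move/le_c; rewrite leq_subRL // -ltnS.
  move=> i j lt_ij le_j; have lt_j : j < n.+1 by [].
  have [_ _ /(_ i lt_ij)] := val j lt_j.
  by rewrite /linked !eq_col // (ltn_trans lt_ij).
- rewrite map_inj_in_uniq ?enum_uniq // => Y Y'; rewrite !mem_enum.
  move=> /in_Rset [sub _] /in_Rset [sub' _] /record_inj eqc.
  by apply/setP => p; rewrite !in_column // eqc // ltnS leq_subr.
- exact: histories_uniq.
Qed.

Local Open Scope ring_scope.

(** * Divergence of the generating function *)

(* Row k, column J of a table is [scale] times a lower bound for the
   generating function of the walks that start with a block of size k on top of
   some stack and end on reaching that stack with accumulated sum J.  Entries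
   outside the table read as 0, which is a valid bound. *)
Definition entry (e : seq (seq N)) (k J : nat) : N := nth 0%num (nth [::] e k) J.

Definition nsum (m : nat) (f : nat -> N) : N :=
  foldr (fun i s => N.add (f i) s) 0%num (iota 0 m).

Definition scale : N := 1000000%num.

Definition unit_if (b : bool) : N := if b then scale else 0%num.

(** The first step, of weight 5/46, either merges at once with sum 0 or pushes a block of size 1,
    whose walk arrives back with sum [J]. Division rounds down, which preserves lower bounds. *)
Definition excursion (e : seq (seq N)) (J : nat) : N :=
  N.div (N.mul 5 (N.add (unit_if (J == 0)) (entry e 1 J))) 46.

(** Decomposition at the first return to the block of size [k], with sum [I]: the merge either takes
    j <= k elements and passes on with J = I + j, or stops and leaves a block of size I + j + 2, to
    which the old table applies. *)
Definition refine_term (h : seq N) (e : seq (seq N)) (k J I : nat) : N :=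
  N.mul (nth 0%num h I)
    (N.add (unit_if (leq I J && leq J (addn I k)))
       (nsum k (fun j : nat => entry e (addn I j).+2 J))).
Definition refine_entry (h : seq N) (e : seq (seq N)) (k J : nat) : N :=
  N.div (nsum 7 (refine_term h e k J)) scale.
Definition step (e : seq (seq N)) : seq (seq N) :=
  let h := [seq excursion e J | J <- iota 0 7] in
  [seq [seq refine_entry h e k J | J <- iota 0 7] | k <- iota 0 11].

Section GreenFunction.

Variable R : realFieldType.

Definition valN (x : N) : R := (N.to_nat x)%:R.

Lemma valN_ge0 x : 0 <= valN x.
Proof. exact: ler0n. Qed.

Lemma valN_add x y : valN (N.add x y) = valN x + valN y.
Proof. by rewrite /valN N2Nat.inj_add natrD. Qed.

Lemma valN_mul x y : valN (N.mul x y) = valN x * valN y.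
Proof. by rewrite /valN N2Nat.inj_mul natrM. Qed.

Lemma valN_div x y : valN y * valN (N.div x y) <= valN x.
Proof.
rewrite -valN_mul ler_nat; have := N.Div0.mul_div_le x y; lia.
Qed.

Lemma valN_nsum m f : valN (nsum m f) = \sum_(0 <= i < m) valN (f i).
Proof.
rewrite /nsum /index_iota subn0; elim: (iota 0 m) => [|i l IH].
  by rewrite big_nil.
by rewrite /= valN_add IH big_cons.
Qed.

Lemma valN0 : valN 0 = 0.
Proof. by rewrite /valN. Qed.

Lemma valN5 : valN 5 = 5.
Proof. by rewrite /valN. Qed.

Lemma valN46 : valN 46 = 46.
Proof. by rewrite /valN. Qed.

Lemma valN_lt x y : N.lt x y -> valN x < valN y.
Proof. by rewrite ltr_nat => lt_xy; lia. Qed.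

Lemma scale_gt0 : 0 < valN scale.
Proof. by rewrite -valN0; apply: valN_lt. Qed.

Definition ratio : R := (5 / 46)%R.

Lemma ratio_ge0 : 0 <= ratio.
Proof. by rewrite divr_ge0 ?ler0n. Qed.

Lemma ratioK x : ratio * (46 * x) = 5 * x.
Proof. by rewrite mulrA divfK ?pnatr_eq0. Qed.

(* Truncated at walk length n, the generating function is finite. *)
Fixpoint green (n : nat) (ks : seq nat) : R :=
  if n is m.+1 then 1 + ratio * \sum_(t <- succs ks) green m t else 1.

Lemma green_ge1 n ks : 1 <= green n ks.
Proof.
elim: n ks => [|n IH] ks; first exact: lexx.
rewrite lerDl; apply: mulr_ge0; first exact: ratio_ge0.
by apply: sumr_ge0 => t _; exact: le_trans ler01 (IH t).
Qed.

Lemma green_ge0 n ks : 0 <= green n ks.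
Proof. exact: le_trans ler01 (green_ge1 n ks). Qed.

Lemma greenS n ks : green n ks <= green n.+1 ks.
Proof.
elim: n ks => [|n IH] ks; first exact: green_ge1.
rewrite [leLHS]/= [leRHS]/= lerD2l ler_wpM2l ?ratio_ge0 // ler_sum // => t _; exact: IH.
Qed.

Lemma green_mono m n ks : (m <= n)%N -> green m ks <= green n ks.
Proof.
move=> mn; rewrite -(subnK mn); elim: (n - m)%N => [|d IH]; first by rewrite add0n.
exact: le_trans IH (greenS _ _).
Qed.

Lemma greenE n ks :
  green n ks = \sum_(0 <= i < n.+1) (ratio) ^+ i * (walks i ks)%:R.
Proof.
elim: n ks => [|n IH] ks; first by rewrite big_nat1 mulr1.
rewrite big_nat_recl // mulr1 [LHS]/=; congr (_ + _).
under eq_bigr => t _ do rewrite IH.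
rewrite exchange_big mulr_sumr; apply: eq_bigr => i _.
by rewrite -mulr_sumr mulrA -exprS /= natr_sum.
Qed.

(** The continuations of a merge that arrives at [ks] with accumulated sum [J]. *)
Definition touch (n J : nat) (ks : seq nat) : R :=
  \sum_(t <- merges J ks) green n t.

Lemma greenSE n ks :
  green n.+1 ks = 1 + ratio * (green n (1%N :: ks) + touch n 0 ks).
Proof. by rewrite [LHS]/= big_cons. Qed.

Lemma touch_ge0 n J ks : 0 <= touch n J ks.
Proof. by apply: sumr_ge0 => t _; exact: green_ge0. Qed.

Lemma touch_mono m n J ks : (m <= n)%N -> touch m J ks <= touch n J ks.
Proof. by move=> mn; apply: ler_sum => t _; exact: green_mono. Qed.

Lemma touch_cons n J k r :
  touch n J (k :: r) =
  \sum_(0 <= j < k.+1) touch n (J + j) r +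
  \sum_(0 <= j < k) green n ((J + j).+2 :: r).
Proof. exact: big_merges_split. Qed.

(** The bound is uniform in the stack [r], so one table serves at every depth; [T] is the additional
    truncation length that it costs. *)
Definition bounds (e : seq (seq N)) (T : nat) : Prop :=
  forall n k r,
    \sum_(0 <= J < 7) valN (entry e k J) * touch n J r <=
    valN scale * green (n + T) (k :: r).

Lemma bounds_nil : bounds [::] 0.
Proof.
move=> n k r; rewrite big1 => [|J _].
  by rewrite mulr_ge0 ?valN_ge0 ?green_ge0.
by rewrite /entry !nth_nil valN0 mul0r.
Qed.

Lemma excursion_bound e T n s : bounds e T ->
  \sum_(0 <= J < 7) valN (excursion e J) * touch n J s <=
  valN scale * green (n + T).+1 s.
Proof.
move=> eT; have H := eT n 1 s.
have H0 : touch n 0 s <= touch (n + T) 0 s by rewrite touch_mono // leq_addr.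
rewrite greenSE.
apply: (@le_trans _ _ (ratio * (valN scale * touch n 0 s +
   \sum_(0 <= J < 7) valN (entry e 1 J) * touch n J s))).
  have -> : valN scale * touch n 0 s =
     \sum_(0 <= J < 7) valN (unit_if (J == 0)) * touch n J s.
    rewrite big_nat_recl // big1; first by rewrite addr0.
    by move=> J _; rewrite /unit_if /= valN0 mul0r.
  rewrite -big_split mulr_sumr; apply: ler_sum => J _ /=.
  rewrite -mulrDl -valN_add mulrA; apply: ler_wpM2r; first exact: touch_ge0.
  have := valN_div (N.mul 5 (N.add (unit_if (J == 0)) (entry e 1 J))) 46.
  rewrite -/(excursion e J) valN_mul => /(ler_wpM2l ratio_ge0).
  by rewrite valN5 valN46 ratioK mulrCA ler_pM2l ?ltr0n.
apply: (@le_trans _ _ (valN scale * (ratio * (touch (n + T) 0 s +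
   green (n + T) (1%N :: s))))).
  rewrite mulrCA ler_wpM2l ?ratio_ge0 // mulrDr lerD //.
  by rewrite ler_wpM2l ?valN_ge0.
by rewrite ler_wpM2l ?valN_ge0 // [touch _ _ _ + _]addrC lerDr.
Qed.

(** Cutting the table off at [m] columns only drops nonnegative terms. *)
Lemma sum_window (g : nat -> R) (m I k : nat) : (forall j, 0 <= g j) ->
  \sum_(0 <= J < m) (if (I <= J <= I + k)%N then g J else 0) <=
  \sum_(0 <= j < k.+1) g (I + j)%N.
Proof.
move=> g0.
have single a : \sum_(0 <= J < m) (if J == a then g J else 0) <= g a.
  by rewrite -big_mkcond big_nat1_eq; case: ifP.
elim: k => [|k IH].
  rewrite big_nat1 addn0; apply: le_trans (single I); apply: ler_sum => J _.
  by rewrite eqn_leq andbC.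
rewrite big_nat_recr //=; apply: le_trans (lerD IH (single _)).
rewrite -big_split; apply: ler_sum => J _ /=; rewrite addnS.
have := g0 J; case: ifP => H; case: ifP => H'; case: ifP => H''; lia || lra.
Qed.

Lemma refine_entry_bound e T k n J r : bounds e T ->
  touch (n + T) J (k :: r) * valN scale >=
  \sum_(0 <= L < 7) valN (N.add (unit_if (J <= L <= J + k)%N)
       (nsum k (fun j : nat => entry e (addn J j).+2 L))) * touch n L r.
Proof.
move=> eT; rewrite touch_cons mulrDl.
under eq_bigr => L _ do rewrite valN_add mulrDl valN_nsum mulr_suml.
rewrite big_split lerD //=.
  have := @sum_window (fun j => touch n j r) 7 J k (fun j => touch_ge0 n j r).
  move=> /(ler_wpM2r (valN_ge0 scale)) => H.
  apply: le_trans (le_trans H _).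
    rewrite mulr_suml; apply: ler_sum => L _.
    by case: ifP => _; rewrite /unit_if ?valN0 ?mul0r // mulrC.
  apply: ler_wpM2r; first exact: valN_ge0.
  by apply: ler_sum => j _; rewrite touch_mono // leq_addr.
rewrite exchange_big mulr_suml /=; apply: ler_sum => j _.
by rewrite mulrC; exact: eT.
Qed.

Lemma entry_step e k J : entry (step e) k J =
  if ((k < 11) && (J < 7))%N
  then refine_entry [seq excursion e J | J <- iota 0 7] e k J else 0%num.
Proof.
rewrite /entry /step; case: ltnP => [lt_k|le_k]; last first.
  by rewrite (nth_default [::]) ?nth_nil // size_map size_iota.
rewrite (nth_map 0%N) ?size_iota // nth_iota //.
case: ltnP => [lt_J|le_J]; last by rewrite nth_default // size_map size_iota.
by rewrite (nth_map 0%N) ?size_iota // nth_iota.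
Qed.

(** The new length is made up of one first step, [T] for the rest of the excursion and [T] for the
    old table used after the return. *)
Lemma bounds_step e T : bounds e T -> bounds (step e) (T + T).+1.
Proof.
move=> eT n k r; rewrite -(ler_pM2l scale_gt0).
rewrite addnS addnA.
apply: le_trans (ler_wpM2l (valN_ge0 _) (excursion_bound (n + T) (k :: r) eT)).
rewrite [leRHS]mulr_sumr.
apply: (@le_trans _ _ (\sum_(0 <= J < 7) valN (excursion e J) *
  \sum_(0 <= L < 7) valN (N.add (unit_if (J <= L <= J + k)%N)
       (nsum k (fun j : nat => entry e (addn J j).+2 L))) * touch n L r)).
  under [leRHS]eq_bigr => J _ do rewrite mulr_sumr.
  rewrite exchange_big mulr_sumr; apply: ler_sum_nat => L /= ltL.
  rewrite entry_step ltL andbT; case: ltnP => _; last first.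
    rewrite valN0 mul0r mulr0 sumr_ge0 // => J _.
    by rewrite !mulr_ge0 ?valN_ge0 ?touch_ge0.
  under eq_bigr => J _ do rewrite mulrA.
  rewrite -mulr_suml mulrA; apply: ler_wpM2r; first exact: touch_ge0.
  apply: le_trans (valN_div _ _) _; rewrite valN_nsum.
  rewrite le_eqVlt; apply/orP; left; apply/eqP.
  apply: eq_big_nat => J /andP [_ ltJ].
  by rewrite /refine_term valN_mul (nth_map 0%N) ?size_iota // nth_iota.
apply: ler_sum => J _.
rewrite [leRHS]mulrCA ler_wpM2l ?valN_ge0 // [leRHS]mulrC.
exact: refine_entry_bound.
Qed.

Lemma bounds_iter i : exists T, bounds (iter i step [::]) T.
Proof.
elim: i => [|i [T IH]]; first by exists 0%N; exact: bounds_nil.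
by exists (T + T).+1; exact: bounds_step.
Qed.

(** The stack [[:: 2]] reproduces itself: an excursion returning with sum 0, followed by taking one
    element of the block, leaves a block of size 1 + 1. *)
Lemma green_expanding : exists c : R, exists T,
  1 < c /\ forall n, c * green n [:: 2%N] <= green (n + T) [:: 2%N].
Proof.
(* 27 is the first iterate whose excursion series exceeds 1. *)
have [T eT] := bounds_iter 27.
set e := iter _ _ _ in eT.
exists (valN (excursion e 0) / valN scale), T.+1; split.
  rewrite ltr_pdivlMr ?scale_gt0 // mul1r; apply: valN_lt.
  by vm_compute.
move=> n; rewrite mulrAC ler_pdivrMr ?scale_gt0 // [leRHS]mulrC addnS.
apply: le_trans (excursion_bound n [:: 2%N] eT).
rewrite big_nat_recl // -[leLHS]addr0 lerD //; last first.
  by apply: sumr_ge0 => J _; rewrite mulr_ge0 ?valN_ge0 ?touch_ge0.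
rewrite ler_wpM2l ?valN_ge0 // touch_cons -[leLHS]add0r lerD //.
  by apply: sumr_ge0 => J _; exact: touch_ge0.
rewrite big_nat_recl // -[leLHS]addr0 lerD //.
by apply: sumr_ge0 => J _; exact: green_ge0.
Qed.

Lemma bernoulli (x : R) q : 0 <= x -> 1 + q%:R * x <= (1 + x) ^+ q.
Proof.
move=> x0; elim: q => [|q IH]; first by rewrite mul0r addr0 expr0.
rewrite exprS; apply: le_trans (ler_wpM2l _ IH); last by lra.
rewrite -natr1; have := ler0n R q; nra.
Qed.

End GreenFunction.

(** * Growth rates of the walk counts *)

Section GrowthRate.

Variable R : archiRealFieldType.

Lemma expr_unbounded (c b : R) : 1 < c ->
  exists q : nat, forall n, (q <= n)%N -> b < c ^+ n.
Proof.
move=> c1; have d0 : 0 < c - 1 by rewrite subr_gt0.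
exists (Num.bound (`|b| / (c - 1))) => n le_n.
have := archi_boundP (divr_ge0 (normr_ge0 b) (ltW d0)).
rewrite ltr_pdivrMr // => lt_b.
have := bernoulli n (ltW d0); rewrite [1 + (c - 1)]addrC subrK => H.
have : (Num.bound (`|b| / (c - 1)))%:R * (c - 1) <= n%:R * (c - 1).
  by rewrite ler_wpM2r ?ler_nat // ltW.
have := ler_norm b; lra.
Qed.

(* Since 91/10 * 5/46 = 91/92, walks growing at most like (91/10)^m would
   bound the generating function by 1 / (1 - 91/92) = 92. *)
Lemma walks_seed : exists m : nat, (91 / 10) ^+ m < (walks m [:: 1%N])%:R :> R.
Proof.
have [c [T [c1 expanding]]] := green_expanding R.
(* One step leads from [[:: 1]] to [[:: 2]], and 1000 * 5/46 exceeds 92. *)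
have [q lt_cq] := @expr_unbounded c 1000 c1.
have green_pow i : c ^+ i <= green R (i * T) [:: 2%N].
  elim: i => [|i IH]; first by rewrite expr0 green_ge1.
  rewrite exprS mulSn addnC; apply: le_trans (expanding _).
  by rewrite ler_wpM2l // ltW // (lt_trans ltr01 c1).
have big_green : 92 < green R (q * T).+1 [:: 1%N].
  rewrite greenSE touch_cons big_nat_recr // !big_nat1.
  have := lt_le_trans (lt_cq q (leqnn q)) (green_pow q).
  have := green_ge0 R (q * T) [:: 1%N; 1%N].
  have := touch_ge0 R (q * T) 0 [::].
  have := touch_ge0 R (q * T) 1 [::].
  rewrite /ratio /= !add0n; lra.
set N := (q * T).+1 in big_green.
have [/forallP small|/forallPn [m]] :=
  boolP [forall i : 'I_N.+1, (walks i [:: 1%N])%:R <= (91 / 10) ^+ i :> R];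
  last by rewrite -ltNge; exists m.
suff : green R N [:: 1%N] <= 92 by rewrite leNgt big_green.
rewrite greenE big_mkord.
have le_geom : \sum_(i < N.+1) ratio R ^+ i * (walks i [:: 1%N])%:R <=
    \sum_(i < N.+1) (91 / 92 : R) ^+ i.
  apply: ler_sum => i _.
  have -> : 91 / 92 = ratio R * (91 / 10) by rewrite /ratio; lra.
  by rewrite [leRHS]exprMn ler_wpM2l ?exprn_ge0 ?ratio_ge0.
apply: le_trans le_geom _.
have := subrX1 (91 / 92 : R) N.+1.
have : 0 <= (91 / 92 : R) ^+ N.+1 by rewrite exprn_ge0 // divr_ge0.
lra.
Qed.

(** Supermultiplicativity extends the seed to multiples of [m]; the factor of at most [a ^+ m] lost
    to the remainder is absorbed by [(a / 9) ^+ n]. *)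
Lemma walks_lower : exists N : nat, forall n : nat, (N <= n)%N ->
  9 ^+ n < (walks n.+1 [:: 1%N])%:R :> R.
Proof.
have [m seed] := walks_seed; set a : R := 91 / 10 in seed.
have a_gt0 : 0 < a by rewrite /a; lra.
have a1 : 1 <= a by rewrite /a; lra.
have m_gt0 : (0 < m)%N.
  by case: m seed => // ; rewrite expr0 ltxx.
have pow q r : a ^+ (q * m) <= (walks (q * m + r) [:: 1%N])%:R.
  elim: q => [|q IH].
    by rewrite expr0 ler1n walks_gt0.
  have := @walks_supermul m (q * m + r) [:: 1%N] isT.
  rewrite addnA -mulSn -(ler_nat R) natrM; apply: le_trans.
  by rewrite mulSn exprD ler_pM ?exprn_ge0 // ltW.
have [N lt_N] : exists N : nat, forall n, (N <= n)%N -> a ^+ m < (a / 9) ^+ n.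
  by apply: expr_unbounded; rewrite /a; lra.
exists N => n /lt_N; rewrite [ltRHS]expr_div_n ltr_pdivlMr ?exprn_gt0 // => lt_n.
have [q [r [r_lt def_n]]] : exists q r, (r < m)%N /\ n.+1 = (q * m + r)%N.
  by exists (n.+1 %/ m)%N, (n.+1 %% m)%N; rewrite ltn_pmod // -divn_eq.
have := pow q r; rewrite -def_n; apply: lt_le_trans.
rewrite -(ltr_pM2l (exprn_gt0 m a_gt0)); apply: lt_le_trans lt_n _.
by rewrite -exprD ler_weXn2l //; lia.
Qed.

Lemma walks_below : exists N : nat, forall n : nat, (N <= n)%N ->
  (walks n.+1 [:: 1%N])%:R < (51 / 4) ^+ n :> R.
Proof.
have [N lt_N] : exists N : nat, forall n, (N <= n)%N -> 76 < (153 / 152 : R) ^+ n.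
  by apply: expr_unbounded; lra.
exists N => n /lt_N lt_n.
(* 51/4 = 153/152 * 38/3, and 76 = 6 * 38/3 absorbs the weight 6 of [:: 1]. *)
have -> : 51 / 4 = 153 / 152 * (38 / 3) :> R by lra.
have := walks_upper n.+1 [:: 1%N].
have -> : weight [:: 1%N] = 6%N by [].
rewrite -(ler_nat R) !natrM !natrX !exprS.
rewrite [(_ * (38 / 3)) ^+ n]exprMn [(38 / 3) ^+ n]expr_div_n.
have : 0 < (3 : R) ^+ n by rewrite exprn_gt0.
set A := 38 ^+ n; set B := 3 ^+ n; set C := _ ^+ n in lt_n *; set W := (walks _ _)%:R.
move=> B0 H.
rewrite -(ltr_pM2r B0) -mulrA divfK ?gt_eqF //.
have A0 : 0 < A by rewrite exprn_gt0.
have : 76 * A < C * A by rewrite ltr_pM2r.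
lra.
Qed.

End GrowthRate.

Theorem corollary21 :
  exists N : nat, forall n : nat, (N <= n)%N ->
    (9 : rat) ^+ n < (Rcard n)%:R /\ (Rcard n)%:R < 12.75%Q ^+ n.
Proof.
have [N1 lower] := walks_lower rat.
have [N2 upper] := walks_below rat.
exists (maxn N1 N2) => n; rewrite geq_max => /andP [le1 le2].
rewrite Rcard_walks; split; first exact: lower.
have <- : 51 / 4 = 12.75%Q by apply/eqP.
exact: upper.
Qed.
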